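(* Every $2$-connected $\{K_{1,3}^{**},K_3\}$-free graph has a longest cycle which is a dominating cycle of the graph.
   Context: All graphs are finite and simple. A cycle $C$ in a graph $G$ is dominating if every edge of $G$ has at least one end vertex on $C$. $G$ is $\{K_{1,3}^{**},K_3\}$-free if it contains neither $K_{1,3}^{**}$ nor a triangle $K_3$ as an induced subgraph. $K_{1,3}^{*}$ is the graph obtained from the claw $K_{1,3}$ by subdividing each edge once, and $K_{1,3}^{**}$ is obtained from $K_{1,3}^{*}$ by deleting one vertex of degree $1$. *)

(* Defs.v *)
From HB Require Import structures.
From mathcomp Require Import all_boot.
Set Implicit Arguments.
Unset Strict Implicit.
Unset Printing Implicit Defensive.

Record sgraph := SGraph {
  vertex :> finType;
  adj : rel vertex;
  adj_sym : symmetric adj;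
  adj_irr : irreflexive adj }.

Section Constructions.

Variable G : sgraph.

Definition sub_adj (A : {set G}) : rel {x : G | x \in A} :=
  fun x y => adj (val x) (val y).

Lemma sub_adj_sym (A : {set G}) : symmetric (@sub_adj A).
Proof. by move=> x y; rewrite /sub_adj adj_sym. Qed.

Lemma sub_adj_irr (A : {set G}) : irreflexive (@sub_adj A).
Proof. by move=> x; rewrite /sub_adj adj_irr. Qed.

Definition induced (A : {set G}) : sgraph :=
  SGraph (@sub_adj_sym A) (@sub_adj_irr A).

Definition del_set (S : {set G}) : sgraph := induced (~: S).

Definition connected_graph : Prop :=
  0 < #|G| /\ forall x y : G, connect (@adj G) x y.

End Constructions.

Definition k_connected (k : nat) (G : sgraph) : Prop :=
  k < #|G| /\ forall S : {set G}, #|S| < k -> connected_graph (del_set S).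

Definition induced_subgraph (H G : sgraph) : Prop :=
  exists f : H -> G,
    injective f /\ forall x y : H, adj (f x) (f y) = adj x y.

Definition free (H G : sgraph) : Prop := ~ induced_subgraph H G.

Section EdgeList.

Variables (n : nat) (s : seq (nat * nat)).

Definition edges_adj : rel 'I_n :=
  fun i j => (i != j) &&
    (((val i, val j) \in s) || ((val j, val i) \in s)).

Lemma edges_adj_sym : symmetric edges_adj.
Proof. by move=> i j; rewrite /edges_adj eq_sym orbC. Qed.

Lemma edges_adj_irr : irreflexive edges_adj.
Proof. by move=> i; rewrite /edges_adj eqxx. Qed.

Definition graph_of_edges : sgraph := SGraph edges_adj_sym edges_adj_irr.

End EdgeList.

Definition K3 : sgraph := graph_of_edges 3 [:: (0, 1); (0, 2); (1, 2)].

(* The centre of the claw is 0, its leaves are 4, 5, 6, and the edge joining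
   0 to i + 3 is subdivided by the vertex i, for i = 1, 2, 3. *)
Definition claw_star : sgraph :=
  graph_of_edges 7 [:: (0, 1); (1, 4); (0, 2); (2, 5); (0, 3); (3, 6)].

(* The deleted vertex 6 has degree 1; by symmetry, deleting 4 or 5 instead
   gives an isomorphic graph. *)
Definition claw_star_star : sgraph :=
  @del_set claw_star [set (ord_max : 'I_7)].

Section Cycles.

Variable G : sgraph.

(* A cycle is represented by the sequence of its vertices, listed from some
   starting vertex in one of the two directions; its length is its size. *)
Definition is_cycle (c : seq G) : Prop :=
  [/\ 2 < size c, uniq c & cycle (@adj G) c].

Definition longest_cycle (c : seq G) : Prop :=
  is_cycle c /\ forall c' : seq G, is_cycle c' -> size c' <= size c.

Definition dominating (c : seq G) : Prop :=
  forall x y : G, adj x y -> x \in c \/ y \in c.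

End Cycles.

(* Main.v *)
(**
Among the longest cycles choose one, C, leaving the fewest edges off C, and
suppose that some component H of G - C contains an edge xy.  If v on C is
adjacent to x, claws centred at v show that v is followed and preceded on C by
v1, v2 and V1, V2 with v2 ~ V1 and V2 ~ v1, so C can be rerouted near v.  By
2-connectedness H has two attachments on C; take v, u at minimal distance m in
G - H.  Centring claws at v with the tail x y, then propagating outwards, shows
that consecutive layers around v (and around u) are completely joined.
For m <= 4 this gives a chord along which C can be rerouted through H, missing
at most two vertices.  For m >= 5 the graph G - H, as far as it is reachable
from C, is a path with vertices blown up to independent sets, with v and u at
its ends; a zigzag from v to u through the layers covers all of C except
possibly one vertex, and is closed up through H.  The new cycle is longer than
C, or equally long with fewer edges off it, or a missed vertex has an off-cycle
neighbour which can be inserted together with it.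
*)
Require Import Defs.
From mathcomp Require Import all_boot.
From mathcomp Require Import zify.

Set Implicit Arguments.
Unset Strict Implicit.
Unset Printing Implicit Defensive.

(** * Forbidden induced subgraphs as adjacency rules *)

Lemma triangle_freeE (G : sgraph) : free K3 G ->
  forall a b c : G, adj a b -> adj b c -> adj a c = false.
Proof.
move=> tf a b c ab bc; apply/negP=> ac; apply: tf.
exists (fun i : 'I_3 => nth a [:: a; b; c] i).
have ba : adj b a by rewrite adj_sym.
have cb : adj c b by rewrite adj_sym.
have ca : adj c a by rewrite adj_sym.
have adjE (i j : 'I_3) :
  adj (nth a [:: a; b; c] i) (nth a [:: a; b; c] j) = (i != j).
  by case: i => [[|[|[|i]]] hi] //; case: j => [[|[|[|j]]] hj] //=;
     rewrite ?adj_irr.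
split=> [i j eij|i j]; last by rewrite adjE; move: i j; case=> [[|[|[|i]]] hi] //; case=> [[|[|[|j]]] hj].
by apply/eqP; move: (adjE i j); rewrite eij adj_irr => /esym/negbFE.
Qed.

(** The form in which the claw condition is used: a claw at [z] with legs [a a'] and [b b'] and leaf
    [c]. Triangle-freeness settles every other pair, so if all five pairs fail, the six vertices
    induce the forbidden graph. *)
Lemma clawE (G : sgraph) : free K3 G -> free claw_star_star G ->
  forall z a a' b b' c : G, adj z a -> adj a a' -> adj z b -> adj b b' ->
  adj z c -> [|| adj a' b', adj a' b, adj a b', adj a' c | adj b' c].
Proof.
move=> tf cf z a a' b b' c za aa' zb bb' zc; apply/negPn/negP.
rewrite !negb_or => /and5P[/negPf a'b' /negPf a'b /negPf ab' /negPf a'c].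
move=> /negPf b'c; apply: cf.
pose F (i : nat) := nth z [:: z; a; b; c; a'; b'] i.
pose E (i j : nat) := let l := [:: (0, 1); (1, 4); (0, 2); (2, 5); (0, 3); (3, 6)] in
  (i != j) && (((i, j) \in l) || ((j, i) \in l)).
have S (x y : G) r : adj x y = r -> adj y x = r by rewrite adj_sym.
have T := triangle_freeE tf.
have ab := T _ _ _ (S _ _ _ za) zb.
have ac := T _ _ _ (S _ _ _ za) zc.
have bc := T _ _ _ (S _ _ _ zb) zc.
have za' := T _ _ _ za aa'.
have zb' := T _ _ _ zb bb'.
have FE i j : i < 6 -> j < 6 -> adj (F i) (F j) = E i j.
  by move: i j => [|[|[|[|[|[|i]]]]]] [|[|[|[|[|[|j]]]]]] // _ _;
     rewrite /F /E /= ?adj_irr //; first [done | exact: S].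
(* The six neighbourhoods are pairwise different, so a map preserving and reflecting adjacency is
   injective. *)
have inj i j : i < 6 -> j < 6 -> (forall k, k < 6 -> E i k = E j k) -> i = j.
  move=> hi hj h.
  have := (h 0 isT, h 1 isT, h 2 isT, h 3 isT, h 4 isT, h 5 isT); move: i j hi hj {h}.
  by move=> [|[|[|[|[|[|i]]]]]] [|[|[|[|[|[|j]]]]]] // _ _ [] [] [] [] [].
have lt6 (x : claw_star_star) : val (val x) < 6.
  have := valP x; rewrite !inE -val_eqE /=; have := ltn_ord (val x).
  by move: (nat_of_ord _) => n; rewrite ltnS leq_eqVlt => /orP[/eqP->|].
exists (fun x : claw_star_star => F (val (val x))).
split=> [x y exy|x y]; last by rewrite FE ?lt6.
apply/val_inj/val_inj/inj; rewrite ?lt6 // => k k6.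
by rewrite -!FE ?lt6 // exy.
Qed.

(** * Walks as vertex lists *)

Section Walks.

Variable G : sgraph.

(** The list contains both ends, so walks are concatenated across an edge; the empty list is no
    walk. *)
Definition walk (x : G) (p : seq G) (y : G) :=
  if p is z :: s then [&& z == x, path (@adj G) x s & last x s == y] else false.

Lemma walk1 x : walk x [:: x] x.
Proof. by rewrite /walk /= !eqxx. Qed.

Lemma walk_cat x y z t p q :
  walk x p y -> adj y z -> walk z q t -> walk x (p ++ q) t.
Proof.
case: p => // x' p /and3P[/eqP-> pp /eqP lp] yz.
case: q => // z' q /and3P[/eqP-> pq /eqP lq].
by rewrite /walk /= eqxx cat_path pp last_cat /= lp yz pq lq eqxx.
Qed.

Lemma walk_cons x y z p : adj x y -> walk y p z -> walk x (x :: p) z.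
Proof. exact: walk_cat (walk1 x). Qed.

Lemma walk_rev x y p : walk x p y -> walk y (rev p) x.
Proof.
elim: p x => // x' p IHp x /and3P[/eqP-> pp /eqP lp].
case: p => [|z p] in IHp pp lp *; first by rewrite -lp /= !eqxx.
case/andP: pp => xz pp; rewrite rev_cons -cats1; apply: (@walk_cat _ z x).
- by apply: IHp; apply/and3P; split=> //; apply/eqP.
- by rewrite adj_sym.
- exact: walk1.
Qed.

Lemma walk_cycle x y p : walk x p y -> adj y x -> cycle (@adj G) p.
Proof.
case: p => // x' p /and3P[/eqP-> pp /eqP lp] yx.
by rewrite /= rcons_path pp lp.
Qed.

Lemma walk_path x s : path (@adj G) x s -> walk x (x :: s) (last x s).
Proof. by move=> ps; rewrite /walk !eqxx ps. Qed.

End Walks.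

(** * Exchanging vertices of an optimal cycle *)

Ltac count_simpl :=
  repeat first [rewrite !(count_cat, count_rev) | progress simpl].

Ltac count_lia Q :=
  count_simpl;
  repeat match goal with
  | |- context [nat_of_bool (Q ?x)] => generalize (nat_of_bool (Q x)); intro
  end; clear; lia.

(** Lists are permutations of each other when every predicate has equal counts on both, which
    becomes linear arithmetic. *)
Ltac perm_count :=
  clear; apply/permP; let Q := fresh "Q" in intro Q; count_lia Q.

Section Exchange.

Variables (G : sgraph) (A : {set G}).

Definition off_edges (B : {set G}) : {set G * G} :=
  [set e | [&& adj e.1 e.2, e.1 \notin B & e.2 \notin B]].

(** Only the vertex set enters, so every cycle on [A], however rotated or rerouted, inherits
    optimality. Off-cycle edges are counted as ordered pairs, which does not affect comparisons. *)
Definition optimal : Prop :=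
  [/\ exists c, [/\ uniq c, cycle (@adj G) c & c =i A], 2 < #|A|
   & forall D : seq G, uniq D -> cycle (@adj G) D -> 2 < size D ->
     size D <= #|A| /\
     (size D = #|A| -> #|off_edges A| <= #|off_edges [set z in D]|)].

Hypothesis optA : optimal.

Variables c P L D : seq G.
Hypotheses (Uc : uniq c) (cA : c =i A) (UP : uniq P).
Hypotheses (PA : forall z, z \in P -> z \notin A).
Hypotheses (cycD : cycle (@adj G) D) (permD : perm_eq (D ++ L) (c ++ P)).

Lemma exchange_uniq : uniq (D ++ L).
Proof.
rewrite (perm_uniq permD) cat_uniq Uc UP andbT /=.
by apply/hasPn=> z /PA; rewrite cA.
Qed.

Lemma size_exchange : size D + size L = #|A| + size P.
Proof.
by have := perm_size permD; rewrite !size_cat -(card_uniqP Uc) (eq_card cA).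
Qed.

(** The cycle [D] trades the vertices [L] for the outside vertices [P], and it cannot be longer than
    a longest cycle. *)
Lemma exchange_le : size P <= size L.
Proof.
have [_ A2 optD] := optA; rewrite leqNgt; apply/negP=> lt.
have := exchange_uniq; rewrite cat_uniq => /and3P[UD _ _].
have := optD D UD cycD; have := size_exchange; lia.
Qed.

(* An exchange that keeps the length and absorbs an off-cycle edge must, by
   the minimality of [off_edges A], free a vertex of another off-cycle edge. *)
Lemma exchange_eq x y : size L <= size P -> x \in P -> adj x y -> y \notin A ->
  (forall l, l \in L -> l \in A) -> exists l z, [/\ l \in L, adj l z & (z \in L) || (z \notin A)].
Proof.
move=> lePL xP xy yA LA.
have [_ A2 optD] := optA; have szE := size_exchange; have leLP := exchange_le.
have := exchange_uniq; rewrite cat_uniq => /and3P[UD /hasPn DL _].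
have [] := optD D UD cycD; first by lia.
move=> _ /(_ ltac:(lia)) le.
have memD z : (z \in D) || (z \in L) = (z \in A) || (z \in P).
  by rewrite -!mem_cat (perm_mem permD) mem_cat cA.
have : ~~ (off_edges [set z in D] \proper off_edges A).
  by apply/negP=> /proper_card; rewrite ltnNge le.
move=> nprop.
have [/existsP[l /existsP[z /and3P[lL lz zD]]]|none] :=
  boolP [exists l, exists z, [&& l \in L, adj l z & z \notin D]].
  exists l, z; split=> //; have := memD z; rewrite (negPf zD) /= => ->.
  by case: (z \in A); rewrite //= orbT.
(* Now [D] meets every neighbour of [L], so no new off-cycle edge arises, while [(x, y)] disappears
   because [x] lies on [D]. *)
case/negP: nprop; apply/properP; split; last first.
  exists (x, y); rewrite !inE /= xy; first by rewrite PA.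
  have := memD x; rewrite xP orbT => /orP[->|/LA]; first by rewrite andbF.
  by rewrite (negPf (PA xP)).
apply/subsetP=> -[p q]; rewrite !inE /= => /and3P[pq pD qD]; rewrite pq /=.
have out r s : adj r s -> r \notin D -> s \notin D -> r \notin A.
  move=> rs rD sD; apply/negP=> rA; have := memD r.
  rewrite (negPf rD) rA /= => rL; case/negP: none.
  by apply/existsP; exists r; apply/existsP; exists s; rewrite rL rs.
by rewrite (out p q) //= (out q p) // adj_sym.
Qed.

End Exchange.

(** * Distance layers and zigzag paths *)

Section Distance.

Variables (G : sgraph) (K : {set G}).

(** Distance from [v] inside [K], axiomatised; outside [K] nothing is imposed except [d v = 0]. *)
Record distance (v : G) (d : G -> nat) : Prop := Distance {
  dist0 : d v = 0;
  dist_eq0 : forall z, z \in K -> d z = 0 -> z = v;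
  dist_adj : forall p q, p \in K -> q \in K -> adj p q -> d q <= (d p).+1;
  dist_pred : forall q n, q \in K -> d q = n.+1 ->
    exists p, [/\ p \in K, adj p q & d p = n] }.

Fixpoint reach (v : G) n z : bool :=
  if n is n'.+1 then [exists p, [&& p \in K, reach v n' p & adj p z]]
  else z == v.

Lemma distance_exists (e : rel G) v : v \in K ->
  (forall p q, p \in K -> e p q -> q \in K /\ adj p q) ->
  (forall z, z \in K -> connect e v z) -> exists d, distance v d.
Proof.
move=> vK eK con.
have ex z : z \in K -> exists n, reach v n z.
  move=> /con/connectP[s + ->] {z}.
  elim/last_ind: s => [|s z IHs]; first by exists 0; rewrite /= eqxx.
  rewrite rcons_path last_rcons => /andP[ps ez].
  have lK : last v s \in K.
    elim: s (v) vK ps {IHs ez} => //= w s IHs a aK /andP[aw].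
    by apply: IHs; case: (eK a w aK aw).
  have [n rn] := IHs ps; exists n.+1; apply/existsP; exists (last v s).
  by apply/and3P; split=> //; case: (eK _ z lK ez).
(* The default 0 outside [K] does no harm, since [dist_eq0] speaks of vertices of [K] only. *)
pose d z := if @eqP _ (z \in K) true is ReflectT h then ex_minn (ex z h) else 0.
have dP z : z \in K -> reach v (d z) z /\ forall n, reach v n z -> d z <= n.
  by rewrite /d; case: (@eqP _ (z \in K) true) => // h _; case: ex_minnP.
have dv0 : d v = 0.
  by apply/eqP; rewrite -leqn0; apply: (dP v vK).2; rewrite /= eqxx.
have dadj p q : p \in K -> q \in K -> adj p q -> d q <= (d p).+1.
  move=> pK qK pq; apply: (dP q qK).2; apply/existsP; exists p.
  by apply/and3P; split=> //; case: (dP p pK).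
exists d; split=> // [z zK dz|q n qK dq].
  by have [] := dP z zK; rewrite dz => /eqP.
have [] := dP q qK; rewrite dq => /existsP[p /and3P[pK rp pq]] _.
exists p; split=> //; have := (dP p pK).2 n rp.
by have := dadj p q pK qK pq; rewrite dq; lia.
Qed.

Lemma level_exists v u d n : u \in K -> distance v d -> n <= d u ->
  exists2 z, z \in K & d z = n.
Proof.
move=> uK D; move e : (d u - n) => k; elim: k n e => [|k IHk] n e le.
  by exists u => //; lia.
have [z zK dz] := IHk n.+1 ltac:(lia) ltac:(lia).
by have [p [pK _ dp]] := dist_pred D zK dz; exists p.
Qed.

Variables (v u : G) (dv du : G -> nat).
Hypotheses (vK : v \in K) (uK : u \in K).
Hypotheses (Dv : distance v dv) (Du : distance u du).

Lemma dist_triangle z : z \in K -> dv u <= dv z + du z.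
Proof.
move e : (du z) => n; elim: n z e => [|n IHn] z e zK.
  by rewrite (dist_eq0 Du zK e) addn0.
have [p [pK pz dp]] := dist_pred Du zK e.
have := dist_adj Dv zK pK; rewrite adj_sym pz => /(_ isT).
by have := IHn p dp pK; lia.
Qed.

Lemma dist_level n : n <= dv u -> exists z, [/\ z \in K, dv z = n & du z <= dv u - n].
Proof.
move e : (dv u - n) => k; elim: k n e => [|k IHk] n e le.
  by exists u; rewrite (dist0 Du); split=> //; lia.
have [z [zK dz uz]] := IHk n.+1 ltac:(lia) ltac:(lia).
have [p [pK pz dp]] := dist_pred Dv zK dz; exists p; split=> //.
by have := dist_adj Du zK pK; rewrite adj_sym pz => /(_ isT); lia.
Qed.

(** The next level contains a vertex of a shortest path from [v] to [u]; being adjacent to it, [z]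
    lies on a shortest path as well. *)
Lemma level_complement z : z \in K ->
  (forall b s, b \in K -> s \in K -> (dv b).+1 < dv u -> dv s = (dv b).+1 -> adj b s) ->
  (dv z).+1 < dv u -> dv z + du z = dv u.
Proof.
move=> zK com lt; have [l [lK dl ul]] := dist_level (ltnW lt).
have zl := com z l zK lK lt dl.
have := dist_adj Du lK zK; rewrite adj_sym => /(_ zl) le.
have := dist_triangle zK; clear -le ul lt; lia.
Qed.

End Distance.

Section Zigzag.

Variables (G : sgraph) (S : seq G) (lev : G -> nat) (r : nat -> nat) (v : G).

(** From [e], alternate between the next level [B] and the leftovers [R] of the current one, ending
    in [B]: this uses all of [R] and one more vertex of [B] than of [R]. *)
Lemma weave (e : G) (R B : seq G) t :
  {in e :: R & B, forall p q, adj p q} -> size B = size R + t + 1 ->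
  exists a q e' (R' : seq G), [/\ adj e a, walk a q e', e' \in B, {subset R' <= B}
    & size R' = t /\ perm_eq (q ++ R') (R ++ B)].
Proof.
elim: R e B => [|b R IHR] e [|a B] /=; try lia.
  move=> eB szB; exists a, [:: a], a, B; split=> //.
  - by apply: eB; rewrite inE eqxx.
  - exact: walk1.
  - exact: mem_head.
  - by move=> z; rewrite inE orbC => ->.
  - by split=> //; lia.
move=> eB szB; have RB : {in b :: R & B, forall p q, adj p q}.
  by move=> p q pR qB; apply: eB; rewrite inE ?pR ?qB orbT.
have [//|a' [q [e' [R' [ba' wq e'B R'B [szR' pq]]]]]] := IHR b B RB; first by lia.
exists a, [:: a, b & q], e', R'; split=> //.
- by apply: eB; rewrite inE eqxx.
- apply: walk_cons _ (walk_cons ba' wq).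
  by rewrite adj_sym; apply: eB; rewrite !inE eqxx ?orbT.
- by rewrite inE e'B orbT.
- by move=> z /R'B; rewrite inE orbC => ->.
- split=> //; move/permP: pq => pq; apply/permP=> Q; move: (pq Q).
  by count_lia Q.
Qed.

Hypothesis levS : {in S &, forall p q, lev q = (lev p).+1 -> adj p q}.
Hypothesis S0 : [seq z <- S | lev z == 0] = [:: v].

(** Here [r i] counts the vertices of level [i] still unvisited when the walk first enters level
    [i.+1]; they are woven in with that level. *)
Lemma zigzag m : r 0 = 0 ->
  (forall i, i < m -> count (fun z => lev z == i.+1) S = r i + r i.+1 + 1) ->
  exists p e (R : seq G), [/\ walk v p e, e \in S /\ lev e = m,
    {in R, forall z, z \in S /\ lev z = m}, size R = r m
    & perm_eq (p ++ R) [seq z <- S | lev z <= m]].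
Proof.
move=> r0; elim: m => [|m IHm] cnt.
  have : v \in [seq z <- S | lev z == 0] by rewrite S0 mem_head.
  rewrite mem_filter => /andP[/eqP lv vS].
  exists [:: v], v, [::]; split=> //; first exact: walk1.
  by rewrite (eq_filter (a2 := fun z => lev z == 0)) ?S0 // => z; rewrite leqn0.
have [p [e [R [wp [eS le] RS szR pR]]]] := IHm (fun i im => cnt i (ltnW im)).
pose B := [seq z <- S | lev z == m.+1].
have BP z : z \in B -> z \in S /\ lev z = m.+1.
  by rewrite mem_filter => /andP[/eqP].
have RB : {in e :: R & B, forall p q, adj p q}.
  move=> a b; rewrite inE => aR /BP[bS lb].
  have [aS la] : a \in S /\ lev a = m by case/orP: aR => [/eqP->|/RS].
  by apply: levS; rewrite ?la.
have szB : size B = size R + r m.+1 + 1 by rewrite size_filter cnt // szR.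
have [a [q [e' [R' [ea wq e'B R'B [szR' pq]]]]]] := weave RB szB.
exists (p ++ q), e', R'; split=> //; try exact: BP.
- exact: walk_cat wp ea wq.
- by move=> z /R'B/BP.
move/permP: pq => pq; move/permP: pR => pR; apply/permP=> Q.
move: (pq Q) (pR Q); rewrite !count_cat !count_filter => eq eR.
have -> : count (predI Q (fun z => lev z <= m.+1)) S =
    count (predI Q (fun z => lev z <= m)) S + count (predI Q (fun z => lev z == m.+1)) S.
  elim: (S) => //= z s ->; case: (Q z) => //=.
  by rewrite [lev z <= m.+1]leq_eqVlt ltnS; case: ltngtP => /=; lia.
by rewrite -eR -addnA eq addnA.
Qed.

End Zigzag.

(** * Level crossings of a cycle *)

Section Ascents.

Variables (G : sgraph) (c : seq G) (lev : G -> nat).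
Hypothesis Uc : uniq c.
Hypothesis cyc : cycle (fun p q => (lev q == (lev p).+1) || (lev p == (lev q).+1)) c.

Definition ascents i := count (fun z => (lev z == i) && (lev (next c z) == i.+1)) c.

Lemma perm_next : perm_eq [seq next c z | z <- c] c.
Proof.
have U : uniq [seq next c z | z <- c].
  by rewrite map_inj_uniq //; apply: can_inj (prev_next Uc).
apply: uniq_perm => //; apply: (uniq_min_size U _ _).2; last by rewrite size_map.
by move=> _ /mapP[z zc ->]; rewrite mem_next.
Qed.

(** A vertex of level [i.+1] is left either upwards or downwards, and the cycle descends from level
    [i.+1] to [i] as often as it ascends. The balance is obtained by summing [hi] over the cycle and
    over its shift by [next]. *)
Lemma count_ascents i :
  count (fun z => lev z == i.+1) c = ascents i + ascents i.+1.
Proof.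
pose hi z := i < lev z.
have step : all (fun z => (lev (next c z) == (lev z).+1) || (lev z == (lev (next c z)).+1)) c.
  by apply/allP=> z zc; have := next_cycle cyc zc.
rewrite /ascents; have eqhi : count (preim (next c) hi) c = count hi c.
  by rewrite -count_map; apply: (permP perm_next).
suff : count (fun z => lev z == i.+1) c + count (preim (next c) hi) c =
  count (fun z => (lev z == i) && (lev (next c z) == i.+1)) c +
  count (fun z => (lev z == i.+1) && (lev (next c z) == i.+2)) c + count hi c.
  by rewrite eqhi => /addIn.
move: (next c) step {eqhi} => nx.
elim: (c) => //= z s IHs /andP[sz /IHs {}IHs].
have : (lev z == i.+1) + hi (nx z) = ((lev z == i) && (lev (nx z) == i.+1)) +
  ((lev z == i.+1) && (lev (nx z) == i.+2)) + hi z.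
  by rewrite /hi; case/orP: sz => /eqP->; do ![case: eqP => ?]; lia.
lia.
Qed.

Lemma count_ascents0 : count (fun z => lev z == 0) c = ascents 0.
Proof.
apply: eq_in_count => z zc; have := next_cycle cyc zc.
by case/orP=> /eqP->; lia.
Qed.

(** Without such an ascent, staying at level at most [i] would propagate along the cycle from [v] to
    [u]. *)
Lemma ascents_gt0 v u i : v \in c -> u \in c -> lev v <= i < lev u ->
  0 < ascents i.
Proof.
move=> vc uc /andP[vi iu]; rewrite /ascents -has_count.
apply: contraTT iu; rewrite -leqNgt => none.
pose e p q := (lev p <= i) ==> (lev q <= i).
have ce : cycle e c.
  apply: cycle_from_next Uc _ => z zc; apply/implyP=> zi; rewrite leqNgt.
  apply: contra none => iz; apply/hasP; exists z => //.
  by have := next_cycle cyc zc; lia.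
have te : transitive e.
  by move=> b a d /implyP ab /implyP bd; apply/implyP=> /ab/bd.
case/splitPr: vc uc ce => a b; rewrite -(rot_cycle (size a)) rot_size_cat.
rewrite mem_cat orbC -mem_cat /= rcons_path => ub.
case/andP=> /(order_path_min te)/allP vs _.
move: ub; rewrite inE => /orP[/eqP->//|].
by move=> /vs/implyP/(_ vi).
Qed.

End Ascents.

(** * Solving the zigzag equations, by parity of the distance *)

Section Leftovers.

Variables (k : nat -> nat) (m : nat).
Hypotheses (k0 : k 0 = 1) (k_gt0 : forall i, i < m -> 0 < k i).
Hypotheses (km1 : k m.-1 = 1) (km : k m = 0).

(** Subtracting 1 at even levels works, as exactly one of [i], [i.+1] is even; for odd [m] the level
    [m], where [k] vanishes, is spared. *)
Lemma leftover_odd : odd m -> exists r : nat -> nat,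
  [/\ r 0 = 0, r m = 0
   & forall i, i < m -> k i + k i.+1 = r i + r i.+1 + 1].
Proof.
move=> om; exists (fun i => k i - ~~ odd i); rewrite k0 km; split=> // i im.
have := k_gt0 im; have : i.+1 < m -> 0 < k i.+1 by apply: k_gt0.
rewrite /=; case: (boolP (odd i)) => oi /=; last by lia.
have : i.+1 != m by apply: contraTneq om => <-; rewrite /= oi.
lia.
Qed.

(** For even [m] one vertex of level [m.-1] is omitted; with nothing left over from there on,
    [k m.-1 = 1] settles the last two equations. *)
Lemma leftover_drop : ~~ odd m -> 1 < m -> exists r : nat -> nat,
  [/\ r 0 = 0, r m = 0
   & forall i, i < m -> k i + k i.+1 = r i + r i.+1 + 1 + (i.+1 == m.-1)].
Proof.
move=> em m1; exists (fun i => if i < m.-1 then k i - ~~ odd i else 0).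
split=> [||i im]; first by rewrite k0; case: ifP.
  by rewrite ifF //; lia.
have := k_gt0 im; have : i.+1 < m -> 0 < k i.+1 by apply: k_gt0.
have [lt|ge] := ltnP i.+1 m.-1.
  by rewrite ifT ?(ltn_eqF lt) /=; [case: (odd i); lia|lia].
have [e|ne] := eqVneq i.+1 m.-1.
  have ki : k i.+1 = 1 by rewrite e.
  have oi : odd i = false.
    have mi : m = i.+2 by lia.
    by move: em; rewrite mi /= negbK; case: (odd i).
  by rewrite ki oi ifT /=; lia.
have e : i = m.-1 by lia.
have ki : k i = 1 by rewrite e.
have ki1 : k i.+1 = 0 by rewrite (_ : i.+1 = m) //; lia.
by rewrite ki ki1 ifF; lia.
Qed.

(** The other repair for even [m]: an extra vertex at level [m.-2] lets all [k m.-2] vertices be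
    left over there. *)
Lemma leftover_add : ~~ odd m -> 3 < m -> exists r : nat -> nat,
  [/\ r 0 = 0, r m = 0
   & forall i, i < m -> k i + k i.+1 + (i.+1 == m.-2) = r i + r i.+1 + 1].
Proof.
move=> em m3.
exists (fun i => if i < m.-2 then k i - ~~ odd i else if i == m.-2 then k i else 0).
split=> [||i im]; first by rewrite k0 ifT //; lia.
  by rewrite !ifF //; lia.
have := k_gt0 im; have : i.+1 < m -> 0 < k i.+1 by apply: k_gt0.
have [lt|ge] := ltnP i.+1 m.-2.
  by rewrite ifT ?(ltn_eqF lt) /=; [case: (odd i); lia|lia].
have [e|ne] := eqVneq i.+1 m.-2.
  have oi : odd i = true.
    have mi : m = i.+3 by lia.
    move: em; rewrite mi.
    by rewrite /= !negbK.
  by rewrite oi ifT /=; lia.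
have [e|ne'] := eqVneq i m.-2.
  have ki : k i.+1 = 1 by rewrite (_ : i.+1 = m.-1) //; lia.
  by rewrite ki ifF ?ifF; lia.
have e : i = m.-1 by lia.
have ki : k i = 1 by rewrite e.
have ki1 : k i.+1 = 0 by rewrite (_ : i.+1 = m) //; lia.
by rewrite ki ki1 ifF; lia.
Qed.

End Leftovers.

(** * A nontrivial component off the cycle *)

Section Component.

Variable G : sgraph.
Hypotheses (tf : free K3 G) (cf : free claw_star_star G).
Variables A H : {set G}.
Hypothesis optA : optimal A.
Hypothesis HA : forall x, x \in H -> x \notin A.
Hypothesis Hwalk : forall x y, x \in H -> y \in H ->
  exists P, [/\ walk x P y, uniq P & {subset P <= H}].
Hypothesis Hnbr : forall x, x \in H -> exists2 y, y \in H & adj x y.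
Hypothesis Hout : forall x z, x \in H -> adj x z -> z \notin A -> z \in H.

Let tri := triangle_freeE tf.
Let claw := clawE tf cf.

(** * Clear and attached vertices, and rerouting near one attached vertex *)

Definition spans (c : seq G) := [/\ uniq c, cycle (@adj G) c & c =i A].

Definition clear (z : G) := [forall x in H, ~~ adj x z].

Definition attached (v : G) := (v \in A) && ~~ clear v.

Lemma adjC (x y : G) : adj x y -> adj y x.
Proof. by rewrite adj_sym. Qed.

Lemma clearE x z : clear z -> x \in H -> adj x z = false.
Proof. by move=> /forall_inP cz xH; apply/negbTE/cz. Qed.

Lemma clearEr x z : clear z -> x \in H -> adj z x = false.
Proof. by rewrite adj_sym; apply: clearE. Qed.

Lemma clear_out z : z \notin A -> z \notin H -> clear z.
Proof.
move=> zA zH; apply/forall_inP=> x xH; apply: contra zH => xz.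
exact: Hout xH xz zA.
Qed.

Lemma attachedP v : attached v ->
  exists x y, [/\ x \in H, y \in H, adj x v & adj x y].
Proof.
case/andP=> _; rewrite negb_forall_in => /exists_inP[x xH /negPn xv].
by have [y yH xy] := Hnbr xH; exists x, y.
Qed.

Lemma rot_spans s t : spans (s ++ t) -> spans (t ++ s).
Proof.
case=> U cyc E; split.
- by rewrite uniq_catC.
- by rewrite -rot_size_cat rot_cycle.
- by move=> z; rewrite mem_cat orbC -mem_cat E.
Qed.

Lemma rev_spans v s : spans (v :: s) -> spans (v :: rev s).
Proof.
case=> U cyc E; apply: (@rot_spans (rev s) [:: v]).
rewrite cats1 -rev_cons; split.
- by rewrite rev_uniq.
- by rewrite rev_cycle (eq_cycle (e' := @adj G)) // => x y; rewrite adj_sym.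
- by move=> z; rewrite mem_rev E.
Qed.

Lemma spans_walk v s : spans (v :: s) -> walk v (v :: s) (last v s) /\ adj (last v s) v.
Proof. by case=> _ /=; rewrite rcons_path => /andP[/walk_path]. Qed.

(** Otherwise the edge [v w] can be replaced by a path through [H], giving a longer cycle. *)
Lemma next_clear v w s : spans (v :: w :: s) -> attached v -> clear w.
Proof.
move=> sp vt; apply/negPn/negP=> wn.
have [U cyc E] := sp.
have wt : attached w by rewrite /attached wn -E !inE eqxx orbT.
have [x [_ [xH _ xv _]]] := attachedP vt.
have [y [_ [yH _ yw _]]] := attachedP wt.
have [P [wP UP PH]] := Hwalk xH yH.
have [] := spans_walk sp; rewrite /walk => /and3P[_ /andP[_ ps] _] lv.
have D : cycle (@adj G) (v :: P ++ w :: s).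
  apply: (@walk_cycle _ v (last w s)) => //.
  by apply: walk_cons (adjC xv) (walk_cat wP yw (walk_path ps)).
have := exchange_le optA U E UP (fun z zP => HA (PH z zP)) D (L := [::]).
move/(_ ltac:(perm_count)).
by case: P wP {UP PH D}.
Qed.

Lemma last_clear v w s : spans (v :: rcons s w) -> attached v -> clear w.
Proof. by move/rev_spans; rewrite rev_rcons; apply: next_clear. Qed.

(** Otherwise [w] can be replaced by a path through [H], so by optimality [w] has an off-cycle
    neighbour [z], which turns out to be insertable too. *)
Lemma next2_clear v w t s : spans (v :: w :: t :: s) -> attached v -> clear t.
Proof.
move=> sp vt; apply/negPn/negP=> tn.
have cw := next_clear sp vt.
have [U cyc E] := sp.
have tt : attached t by rewrite /attached tn -E !inE eqxx !orbT.
have [x [x' [xH x'H xv xx']]] := attachedP vt.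
have [y [_ [yH _ yt _]]] := attachedP tt.
have [P [wP UP PH]] := Hwalk xH yH.
have [] := spans_walk sp; rewrite /walk => /and3P[_ /and3P[vw wt ps] _] lv.
have PA z : z \in P -> z \notin A by move/PH/HA.
have D : cycle (@adj G) (v :: P ++ t :: s).
  apply: (@walk_cycle _ v (last t s)) => //.
  by apply: walk_cons (adjC xv) (walk_cat wP yt (walk_path ps)).
have pD : perm_eq ((v :: P ++ t :: s) ++ [:: w]) ((v :: w :: t :: s) ++ P).
  by perm_count.
have xP : x \in P by case: (P) wP => // z q /andP[/eqP-> _]; rewrite inE eqxx.
have [] := exchange_eq optA U E UP PA D pD _ xP xx' (HA x'H).
- by case: (P) xP.
- by move=> l; rewrite inE -E => /eqP->; rewrite !inE eqxx orbT.
move=> l [z []]; rewrite !inE => /eqP-> wz; case/orP=> [/eqP zw|zA].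
  by rewrite zw adj_irr in wz.
have zH : z \notin H by apply/negP=> /(clearEr cw); rewrite wz.
have cz := clear_out zA zH.
pose l' := last t s.
have cl' : clear l'.
  apply: (@last_clear v l' (w :: belast t s)) vt.
  by rewrite rcons_cons -lastI.
(* The claw at [v] with legs [x x'], [w z] and leaf [l'] leaves only the adjacency of [z] and
   [l']. *)
have := claw (adjC xv) xx' vw wz (adjC lv).
rewrite (clearE cz x'H) (clearE cw x'H) (clearE cz xH) (clearE cl' x'H) /=.
rewrite -/l' => zl'.
have sz : size P = 1.
  by have := exchange_le optA U E UP PA D pD; case: (P) xP => // a [].
have Px : P = [:: x].
  by case: (P) sz xP => // a [] //= _; rewrite inE => /eqP->.
have yx : y = x by move: wP; rewrite Px /walk /= => /andP[_ /eqP].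
rewrite {}yx in yt.
(* The cycle [z w v x t .. l'] gains [x] and [z] and loses nothing. *)
have D' : cycle (@adj G) ([:: z; w; v; x] ++ t :: s).
  apply: (@walk_cycle _ z l'); last exact: adjC.
  apply: walk_cons (adjC wz) _; apply: walk_cons (adjC vw) _.
  apply: walk_cons (adjC xv) _; apply: walk_cons yt (walk_path ps).
have := exchange_le optA U E _ _ D' (L := [::]) (P := [:: x; z]).
have xz : x != z by apply: contraNneq zH => <-.
move/(_ _ _ ltac:(perm_count)); rewrite /= inE xz => h.
suff : 2 <= 0 by []; apply: h => // z'; rewrite !inE => /orP[]/eqP-> //.
exact: HA.
Qed.

(** In the claw at [v] with legs [x y] and [w t] and the last vertex as leaf, each other possible
    adjacency joins [H] to a clear vertex. *)
Lemma chord v w t s : spans (v :: w :: t :: s) -> attached v -> adj t (last t s).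
Proof.
move=> sp vt; have [x [y [xH yH xv xy]]] := attachedP vt.
have cw := next_clear sp vt; have ct := next2_clear sp vt.
have [] := spans_walk sp; rewrite /walk => /and3P[_ /and3P[vw wt ps] _] lv.
have cl : clear (last t s).
  apply: (@last_clear v _ (w :: belast t s)) vt.
  by rewrite rcons_cons -lastI.
have := claw (adjC xv) xy vw wt (adjC lv).
by rewrite (clearE ct yH) (clearE cw yH) (clearE ct xH) (clearE cl yH).
Qed.

Lemma link u v : attached u -> attached v -> exists x y P,
  [/\ adj v x, adj y u, walk x P y, uniq P & {subset P <= H}] /\ x \in P.
Proof.
case/attachedP=> y [_ [yH _ yu _]] /attachedP[x [_ [xH _ xv _]]].
have [P [wP UP PH]] := Hwalk xH yH; exists x, y, P; split; first by split=> //; exact: adjC.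
by case: (P) wP => // z q /andP[/eqP-> _]; rewrite inE eqxx.
Qed.

(* A spanning cycle cut open at two attached vertices [v] and [u]:
   [v v1 v2 .. u2 u1 u U1 U2 .. V2 V1], with [X = v2 .. u2], [Y = U2 .. V2]. *)
Record frame v v1 v2 X u2 u1 u U1 U2 Y V2 V1 : Prop := Frame {
  frame_spans : spans (v :: v1 :: X ++ u1 :: u :: U1 :: Y ++ [:: V1]);
  frame_X : walk v2 X u2;
  frame_Y : walk U2 Y V2;
  frame_vv1 : adj v v1;
  frame_v1v2 : adj v1 v2;
  frame_u2u1 : adj u2 u1;
  frame_u1u : adj u1 u;
  frame_uU1 : adj u U1;
  frame_U1U2 : adj U1 U2;
  frame_V2V1 : adj V2 V1;
  frame_V1v : adj V1 v;
  frame_v : attached v;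
  frame_u : attached u }.

(** Together with [frame_swap] this carries a fact proved at one of the four corners of a frame to
    the other three. *)
Lemma frame_flip v v1 v2 X u2 u1 u U1 U2 Y V2 V1 :
  frame v v1 v2 X u2 u1 u U1 U2 Y V2 V1 ->
  frame v V1 V2 (rev Y) U2 U1 u u1 u2 (rev X) v2 v1.
Proof.
case=> sp wX wY *; split; try exact: walk_rev; try exact: adjC; try done.
move/rev_spans: sp.
by rewrite rev_cons rev_cat !rev_cons rev_cat /= -!cats1 -!catA.
Qed.

Lemma frame_swap v v1 v2 X u2 u1 u U1 U2 Y V2 V1 :
  frame v v1 v2 X u2 u1 u U1 U2 Y V2 V1 ->
  frame u U1 U2 Y V2 V1 v v1 v2 X u2 u1.
Proof.
case=> sp *; split=> //.
have := @rot_spans (v :: v1 :: X ++ [:: u1]) (u :: U1 :: Y ++ [:: V1]).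
by rewrite /= -!catA /=; apply.
Qed.

Section Frame.

Variables (v v1 v2 : G) (X : seq G) (u2 u1 u U1 U2 : G) (Y : seq G) (V2 V1 : G).
Hypothesis F : frame v v1 v2 X u2 u1 u U1 U2 Y V2 V1.

Lemma frame_v1_clear : clear v1.
Proof. by case: F => sp *; apply: next_clear sp _. Qed.

Lemma frame_v2_clear : clear v2.
Proof.
by case: F; case: X => // z s sp /and3P[/eqP<- _ _] *; apply: next2_clear sp _.
Qed.

Lemma frame_chord : adj v2 V1.
Proof.
case: F; case: X => // z s sp /and3P[/eqP<- _ _] *.
have := chord sp; rewrite last_cat /= last_cat; exact.
Qed.

End Frame.

Lemma frame_clear v v1 v2 X u2 u1 u U1 U2 Y V2 V1 :
  frame v v1 v2 X u2 u1 u U1 U2 Y V2 V1 ->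
  [/\ clear v1, clear v2, clear V1 & clear V2] /\
  [/\ clear u1, clear u2, clear U1 & clear U2].
Proof.
move=> F; have F' := frame_flip F; have S := frame_swap F.
have S' := frame_flip S.
by rewrite (frame_v1_clear F) (frame_v2_clear F) (frame_v1_clear F')
  (frame_v2_clear F') (frame_v1_clear S) (frame_v2_clear S)
  (frame_v1_clear S') (frame_v2_clear S').
Qed.

Lemma frame_chords v v1 v2 X u2 u1 u U1 U2 Y V2 V1 :
  frame v v1 v2 X u2 u1 u U1 U2 Y V2 V1 ->
  [/\ adj v2 V1, adj V2 v1, adj U2 u1 & adj u2 U1].
Proof.
move=> F; have F' := frame_flip F; have S := frame_swap F.
have S' := frame_flip S.
by rewrite (frame_chord F) (frame_chord F') (frame_chord S) (frame_chord S').
Qed.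

(** Otherwise go from [v] through [H] to [u], back along [p] to [v1], over to [U1] and along [q] to
    [V1]: a longer cycle. *)
Lemma crossing v p u q v1 u1 U1 V1 : spans (v :: p ++ u :: q) ->
  attached v -> attached u -> walk v1 p u1 -> walk U1 q V1 ->
  adj u1 u -> adj V1 v -> adj v1 U1 = false.
Proof.
move=> [U cyc E] vt ut wp wq u1u V1v; apply/negP=> v1U1.
have [x [y [P [[vx yu wP UP PH] _]]]] := link ut vt.
have D : cycle (@adj G) (v :: P ++ u :: rev p ++ q).
  apply: (@walk_cycle _ v V1) => //; apply: walk_cons vx (walk_cat wP yu _).
  by apply: walk_cons (adjC u1u) (walk_cat (walk_rev wp) v1U1 wq).
have := exchange_le optA U E UP (fun z zP => HA (PH z zP)) D (L := [::]).
move/(_ ltac:(perm_count)).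
by case: P wP {UP PH D}.
Qed.

Lemma frame_exists c v u : spans c -> attached v -> attached u -> u != v ->
  exists v1 v2 X u2 u1 U1 U2 Y V2 V1, frame v v1 v2 X u2 u1 u U1 U2 Y V2 V1.
Proof.
move=> sp vt ut uv.
have vc : v \in c by case: sp => _ _ ->; case/andP: vt.
have uc : u \in c by case: sp => _ _ ->; case/andP: ut.
have [s {}sp us] : exists2 s, spans (v :: s) & u \in s.
  case/splitPr: vc sp uc => a b sp uc; exists (b ++ a).
    exact: (@rot_spans a (v :: b)).
  by move: uc; rewrite !mem_cat inE (negPf uv) /= orbC.
case/splitPr: us sp => p q sp.
have sp' : spans (u :: q ++ v :: p).
  by have := @rot_spans (v :: p) (u :: q); apply.
have arc w t a b : spans (w :: a ++ t :: b) -> attached w -> attached t -> exists w1 w2 a' t1, a = w1 :: w2 :: rcons a' t1.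
  move=> sw wt tt; have tn : ~~ clear t by case/andP: tt.
  case: a sw => [|w1 a] /= sw; first by rewrite (next_clear sw wt) in tn.
  case: a sw => [|w2 a] /= sw; first by rewrite (next2_clear sw wt) in tn.
  case/lastP: a sw => [|a t1] sw; last by exists w1, w2, a, t1.
  (* If the arc were just [w1 w2], the chord at [t] would join [w1] to [b0], against [crossing]. *)
  have sr : spans (t :: b ++ [:: w; w1; w2]).
    exact: (@rot_spans (w :: [:: w1; w2]) (t :: b) sw).
  case: b sw sr => [|b0 b] sw sr.
    by rewrite (@last_clear w t [:: w1; w2] sw wt) in tn.
  move/rev_spans: sr; rewrite rev_cat /=.
  move/chord/(_ tt); rewrite /= rev_cons last_rcons /= => w1b0.
  have [] := sw; rewrite /= rcons_path => _.
  move=> /and5P[_ w12 w2t tb0 /andP[pb lw]] _.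
  have ww : walk w1 [:: w1; w2] w2 by apply: walk_cons w12 (walk1 _).
  by rewrite (@crossing w [:: w1; w2] t (b0 :: b) _ _ _ _ sw wt tt ww (walk_path pb)) in w1b0.
have [v1 [v2 [X [u1 ep]]]] := arc _ _ _ _ sp vt ut.
have [U1 [U2 [Y [V1 eq]]]] := arc _ _ _ _ sp' ut vt.
exists v1, v2, (v2 :: X), (last v2 X), u1, U1, U2, (U2 :: Y), (last U2 Y), V1.
have [] := sp; rewrite ep eq -!cats1 /= -!catA /= => _.
rewrite rcons_cat /= rcons_cat /= !cat_path /= !cat_path /=.
move=> /and5P[a1 a2 pX a3 /and5P[a4 a5 a6 pY /and3P[a7 a8 _]]] _.
split=> //; try exact: walk_path.
by move: sp; rewrite ep eq -!cats1 /= -!catA.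
Qed.

(** Claw at [v] with legs [x y] and [V1 z] and leaf [v1]. *)
Lemma frame_z v v1 v2 X u2 u1 u U1 U2 Y V2 V1 z :
  frame v v1 v2 X u2 u1 u U1 U2 Y V2 V1 -> z \notin A -> adj V1 z ->
  z \notin H /\ adj v1 z.
Proof.
move=> F zA V1z; have [[cv1 _ cV1 _] _] := frame_clear F.
have zH : z \notin H by apply/negP=> /(clearEr cV1); rewrite V1z.
split=> //; have cz := clear_out zA zH.
have [x [y [xH yH xv xy]]] := attachedP (frame_v F).
have := claw (adjC xv) xy (adjC (frame_V1v F)) V1z (frame_vv1 F).
by rewrite (clearE cz yH) (clearE cV1 yH) (clearE cz xH) (clearE cv1 yH) /= adj_sym.
Qed.

(* [V1] is the only vertex of [A] missed by the rerouted cycle; an off-cycle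
   neighbour [z] of [V1] is also one of [v1], so [z V1] can be put back. *)
Lemma frame_reroute v v1 v2 X u2 u1 u U1 U2 Y V2 V1 r R :
  frame v v1 v2 X u2 u1 u U1 U2 Y V2 V1 ->
  walk r R v1 -> adj u r ->
  perm_eq (R ++ [:: V1]) (v1 :: X ++ u1 :: U1 :: Y ++ [:: V1]) -> False.
Proof.
move=> F wR ur pR.
have [U _ E] := frame_spans F.
have [x [y [P [[vx yu wP UP PH] xP]]]] := link (frame_u F) (frame_v F).
have PA z : z \in P -> z \notin A by move/PH/HA.
have D : cycle (@adj G) (v :: P ++ u :: R).
  apply: (@walk_cycle _ v v1); last exact: adjC (frame_vv1 F).
  exact: walk_cons vx (walk_cat wP yu (walk_cons ur wR)).
have pD : perm_eq ((v :: P ++ u :: R) ++ [:: V1])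
    ((v :: v1 :: X ++ u1 :: u :: U1 :: Y ++ [:: V1]) ++ P).
  move/permP: pR => pR; apply/permP=> Q; move: (pR Q).
  count_lia Q.
have [x' x'H xx'] := Hnbr (PH x xP).
have [] := exchange_eq optA U E UP PA D pD _ xP xx' (HA x'H).
- by case: (P) xP.
- by move=> l; rewrite inE -E => /eqP->; rewrite !(inE, mem_cat) eqxx !orbT.
move=> l [z []]; rewrite !inE => /eqP-> V1z; case/orP=> [/eqP zw|zA].
  by rewrite zw adj_irr in V1z.
have [zH v1z] := frame_z F zA V1z.
have D' : cycle (@adj G) (v :: P ++ u :: R ++ [:: z; V1]).
  apply: (@walk_cycle _ v V1); last exact: frame_V1v F.
  apply: walk_cons vx (walk_cat wP yu (walk_cons ur (walk_cat wR v1z _))).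
  exact: walk_cons (adjC V1z) (walk1 _).
have := exchange_le optA U E _ _ D' (L := [::]) (P := z :: P).
have -> : uniq (z :: P) by rewrite /= UP andbT; apply: contra zH => /PH.
move=> /(_ isT) h; suff : size (z :: P) <= 0 by [].
apply: h => [t|]; first by rewrite inE => /orP[/eqP->|/PA].
move/permP: pD => pD; apply/permP=> Q; move: (pD Q).
count_lia Q.
Qed.

(* [v1] and [V1] can be exchanged, both being adjacent to [v], [v2], [V2]. *)
Lemma frame_twist v v1 v2 X u2 u1 u U1 U2 Y V2 V1 :
  frame v v1 v2 X u2 u1 u U1 U2 Y V2 V1 ->
  frame v V1 v2 X u2 u1 u U1 U2 Y V2 v1.
Proof.
move=> F; have [v2V1 V2v1 _ _] := frame_chords F.
case: F => [[Uc _ E] wX wY vv1 v1v2 u2u1 u1u uU1 U1U2 V2V1 V1v vt ut].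
split=> //; try exact: adjC.
have p : perm_eq (v :: V1 :: X ++ u1 :: u :: U1 :: Y ++ [:: v1])
   (v :: v1 :: X ++ u1 :: u :: U1 :: Y ++ [:: V1]) by perm_count.
split; first by rewrite (perm_uniq p).
  apply: (@walk_cycle _ v v1); last exact: adjC.
  apply: walk_cons (adjC V1v) (walk_cons (adjC v2V1) (walk_cat wX u2u1 _)).
  apply: walk_cons u1u (walk_cons uU1 (walk_cons U1U2 _)).
  exact: walk_cat wY V2v1 (walk1 _).
by move=> z; rewrite (perm_mem p) E.
Qed.

(** * Non-adjacencies between the surroundings of two attached vertices *)

Lemma frame_v1U1 v v1 v2 X u2 u1 u U1 U2 Y V2 V1 :
  frame v v1 v2 X u2 u1 u U1 U2 Y V2 V1 -> adj v1 U1 = false.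
Proof.
case=> sp wX wY vv1 v1v2 u2u1 u1u uU1 U1U2 V2V1 V1v vt ut.
have sp' : spans (v :: (v1 :: X ++ [:: u1]) ++ u :: (U1 :: Y ++ [:: V1])).
  by rewrite /= -catA.
apply: crossing sp' vt ut _ _ u1u V1v.
  exact: walk_cons v1v2 (walk_cat wX u2u1 (walk1 _)).
exact: walk_cons U1U2 (walk_cat wY V2V1 (walk1 _)).
Qed.

(** Otherwise [u u1 u2 .. v2 U1 U2 .. V2 v1 v], closed through [H], misses only [V1]. *)
Lemma frame_v2U1 v v1 v2 X u2 u1 u U1 U2 Y V2 V1 :
  frame v v1 v2 X u2 u1 u U1 U2 Y V2 V1 -> adj v2 U1 = false.
Proof.
move=> F; have [v2V1 V2v1 U2u1 u2U1] := frame_chords F.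
have [_ wX wY vv1 v1v2 u2u1 u1u uU1 U1U2 V2V1 V1v _ _] := F.
apply/negP=> v2U1.
apply: (@frame_reroute _ _ _ _ _ _ _ _ _ _ _ _ u1 (u1 :: rev X ++ U1 :: Y ++ [:: v1]) F).
- apply: walk_cons (adjC u2u1) (walk_cat (walk_rev wX) v2U1 _).
  exact: walk_cons U1U2 (walk_cat wY V2v1 (walk1 _)).
- exact: adjC.
- by perm_count.
Qed.

(** Otherwise [u U1 V2 .. U2 u1 u2 .. v2 v1 v], closed through [H], misses only [V1]. *)
Lemma frame_V2U1 v v1 v2 X u2 u1 u U1 U2 Y V2 V1 :
  frame v v1 v2 X u2 u1 u U1 U2 Y V2 V1 -> adj V2 U1 = false.
Proof.
move=> F; have [v2V1 V2v1 U2u1 u2U1] := frame_chords F.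
have [_ wX wY vv1 v1v2 u2u1 u1u uU1 U1U2 V2V1 V1v _ _] := F.
apply/negP=> V2U1.
apply: (@frame_reroute _ _ _ _ _ _ _ _ _ _ _ _ U1 (U1 :: rev Y ++ u1 :: rev X ++ [:: v1]) F).
- apply: walk_cons (adjC V2U1) (walk_cat (walk_rev wY) U2u1 _).
  exact: walk_cons (adjC u2u1) (walk_cat (walk_rev wX) (adjC v1v2) (walk1 _)).
- done.
- by perm_count.
Qed.

(** If [u] and [v] were adjacent, claws at [v] would make [u] adjacent to [y] and to [V2]. Then
    [v x y u V2 .. U2 U1 u2 .. v2 v1] is a cycle missing only [V1] and [u1], and an off-cycle
    neighbour of either allows that vertex to be put back. *)
Lemma frame_nonadj v v1 v2 X u2 u1 u U1 U2 Y V2 V1 :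
  frame v v1 v2 X u2 u1 u U1 U2 Y V2 V1 -> adj u v = false.
Proof.
move=> F; apply/negP=> uv.
have [[cv1 cv2 cV1 cV2] [cu1 cu2 cU1 cU2]] := frame_clear F.
have [_ _ _ u2U1] := frame_chords F.
have V1U1 := frame_v1U1 (frame_twist F).
have u1V1 := frame_v1U1 (frame_flip F).
have u1V1' : adj u1 V1 = false by rewrite adj_sym.
have U1V1 : adj U1 V1 = false by rewrite adj_sym.
have U1V2 : adj U1 V2 = false by rewrite adj_sym (frame_V2U1 F).
have [[Uc _ E] wX wY vv1 v1v2 u2u1 u1u uU1 U1U2 V2V1 V1v vt _] := F.
have [x [y [xH yH xv xy]]] := attachedP vt.
have yu : adj y u.
  have := claw (adjC xv) xy (adjC uv) (adjC u1u) (adjC V1v).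
  by rewrite u1V1' (clearE cu1 yH) (clearE cu1 xH) (clearE cV1 yH) /= !orbF.
have uV2 : adj u V2.
  have := claw (adjC uv) uU1 (adjC V1v) (adjC V2V1) (adjC xv).
  by rewrite U1V2 U1V1 (clearEr cU1 xH) (clearEr cV2 xH) /= !orbF.
pose P := [:: x; y]; pose L := [:: V1; u1].
have UP : uniq P.
  by rewrite /= inE andbT; apply/eqP=> e; rewrite e adj_irr in xy.
have PH z : z \in P -> z \in H by rewrite !inE => /orP[]/eqP->.
have PA z : z \in P -> z \notin A by move/PH/HA.
pose R := rev Y ++ U1 :: rev X ++ [:: v1].
have wR : walk V2 R v1.
  apply: walk_cat (walk_rev wY) (adjC U1U2) (walk_cons (adjC u2U1) _).
  exact: walk_cat (walk_rev wX) (adjC v1v2) (walk1 _).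
have wP : walk x P y by apply: walk_cons xy (walk1 _).
have D : cycle (@adj G) (v :: P ++ u :: R).
  apply: (@walk_cycle _ v v1); last exact: adjC.
  exact: walk_cons (adjC xv) (walk_cat wP yu (walk_cons uV2 wR)).
have pD : perm_eq ((v :: P ++ u :: R) ++ L)
    ((v :: v1 :: X ++ u1 :: u :: U1 :: Y ++ [:: V1]) ++ P).
  by rewrite /P /R /L; perm_count.
have [] := exchange_eq optA Uc E UP PA D pD (leqnn 2) (mem_head _ _) xy (HA yH).
  by move=> l; rewrite !inE -E => /orP[]/eqP->; rewrite !(inE, mem_cat) eqxx !orbT.
(* A cycle that also absorbs [z] and misses a single vertex [l] gains three vertices and loses
   one. *)
have insert z R' : z \notin A -> z \notin H -> walk V2 R' v1 \/ walk V2 R' V1 ->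
    forall l, perm_eq (R' ++ [:: l]) (z :: R ++ L) -> False.
  move=> zA zH wR' l pR'.
  have D' : cycle (@adj G) (v :: P ++ u :: R').
    case: wR' => wR'; [apply: (@walk_cycle _ v v1) (adjC vv1)|
      apply: (@walk_cycle _ v V1) V1v];
      exact: walk_cons (adjC xv) (walk_cat wP yu (walk_cons uV2 wR')).
  have := exchange_le optA Uc E _ _ D' (L := [:: l]) (P := z :: P).
  have -> : uniq (z :: P) by rewrite cons_uniq UP andbT; apply: contra zH => /PH.
  move=> /(_ isT) h; suff : size (z :: P) <= 1 by [].
  apply: h => [t|]; first by rewrite inE => /orP[/eqP->|/PA].
  move/permP: pR' => pR'; move/permP: pD => pD; apply/permP=> Q.
  move: (pD Q) (pR' Q).
  count_lia Q.
move=> l [z []]; rewrite /L !inE => /orP[]/eqP-> lz;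
  case/orP=> [/orP[]/eqP zw|zA]; rewrite ?zw ?adj_irr ?u1V1 ?u1V1' // in lz.
  have [zH v1z] := frame_z F zA lz.
  apply: (insert z (R ++ [:: z; V1]) zA zH _ u1); last by rewrite /L; perm_count.
  right; apply: walk_cat wR v1z (walk_cons (adjC lz) (walk1 _)).
have [zH U1z] := frame_z (frame_swap F) zA lz.
apply: (insert z (rev Y ++ [:: U1; z; u1] ++ rev X ++ [:: v1]) zA zH _ V1).
  left; apply: walk_cat (walk_rev wY) (adjC U1U2) _.
  apply: walk_cons U1z (walk_cons (adjC lz) (walk_cons (adjC u2u1) _)).
  exact: walk_cat (walk_rev wX) (adjC v1v2) (walk1 _).
by rewrite /L /R; perm_count.
Qed.

Lemma attached_nonadj c u v : spans c -> attached u -> attached v ->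
  adj u v = false.
Proof.
move=> sp ut vt; have [->|uv] := eqVneq u v; first exact: adj_irr.
have [v1 [v2 [X [u2 [u1 [U1 [U2 [Y [V2 [V1 F]]]]]]]]]] := frame_exists sp vt ut uv.
exact: frame_nonadj F.
Qed.

(** A claw at [v] makes [v2] adjacent to [w]; then the claw at [u] with legs [x' y'] and [w v2] and
    leaf [U1] has no adjacency left. *)
Lemma frame_no_common_nbr v v1 v2 X u2 u1 u U1 U2 Y V2 V1 w :
  frame v v1 v2 X u2 u1 u U1 U2 Y V2 V1 -> w \notin H -> adj v w -> adj w u ->
  False.
Proof.
move=> F wH vw wu.
have [[cv1 cv2 cV1 cV2] [cu1 cu2 cU1 cU2]] := frame_clear F.
have cw : clear w.
  have [wA|wA] := boolP (w \in A); last exact: clear_out.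
  apply/negPn/negP=> nw; have wt : attached w by rewrite /attached wA.
  by rewrite (attached_nonadj (frame_spans F) (frame_v F) wt) in vw.
have [x [y [xH yH xv xy]]] := attachedP (frame_v F).
have [x' [y' [x'H y'H xu xy']]] := attachedP (frame_u F).
have v2w : adj v2 w.
  have := claw (adjC xv) xy (frame_vv1 F) (frame_v1v2 F) vw.
  by rewrite (clearE cv2 yH) (clearE cv1 yH) (clearE cv2 xH) (clearE cw yH).
have := claw (adjC xu) xy' (adjC wu) (adjC v2w) (frame_uU1 F).
by rewrite (clearE cv2 y'H) (clearE cw y'H) (clearE cv2 x'H) (clearE cU1 y'H) (frame_v2U1 F).
Qed.

(** * Distance layers outside [H] *)

Section Layers.

Variable K : {set G}.
Hypothesis KH : forall z, z \in K -> z \notin H.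

Lemma layers_complete v u d : attached v -> v \in K -> u \in K -> distance K v d ->
  (forall z, z \in K -> 0 < d z < d u -> clear z) ->
  forall i, i.+1 < d u -> forall b s, b \in K -> s \in K ->
  d b = i -> d s = i.+1 -> adj b s.
Proof.
move=> vt vK uK D cl.
have dadj p q : p \in K -> q \in K -> adj p q -> d q <= (d p).+1.
  exact: (dist_adj D).
pose C i := forall b s, b \in K -> s \in K -> d b = i -> d s = i.+1 -> adj b s.
(* [c c' c''] is a tail from layer [i - 1] back towards [v] and [H]. *)
pose T i := exists c c' c'', [/\ forall a, a \in K -> d a = i -> adj c a,
    adj c c', adj c' c'', forall z, z \in K -> i < d z < d u -> adj c' z = false
  & forall z, z \in K -> i <= d z < d u -> adj c'' z = false] /\
  forall z, z \in K -> i < d z < d u -> adj c z = false.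
(* Claw at [c] with legs [c' c''] and [a s] and leaf [b], where [a] is a predecessor of [s]: only
   [b s] can be an edge. *)
have TC i : i.+1 < d u -> T i -> C i.
  move=> iu [c [c' [c'' [[ca cc' c'c'' c'z c''z] _]]]] b s bK sK db ds.
  have [a [aK as_ da]] := dist_pred D sK ds.
  have := claw cc' c'c'' (ca a aK da) as_ (ca b bK db).
  rewrite (c''z s sK) ?ds ?leqnSn ?iu // (c''z a aK) ?da ?leqnn ?(ltnW iu) //.
  rewrite (c'z s sK) ?ds ?ltnSn ?iu // (c''z b bK) ?db ?leqnn ?(ltnW iu) //.
  by rewrite /= adj_sym.
have T1 : T 1.
  have [x [y [xH yH xv xy]]] := attachedP vt.
  exists v, x, y; split; first split=> //; try exact: adjC.
  - move=> a aK da; have [p [pK pa dp]] := dist_pred D aK da.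
    by rewrite -(dist_eq0 D pK dp).
  - by move=> z zK /andP[/ltnW h ?]; apply: clearE xH; apply: cl => //; apply/andP.
  - by move=> z zK hz; apply: clearE yH; apply: cl.
  move=> z zK /andP[hz _]; apply/negP=> vz.
  by have := dadj v z vK zK vz; rewrite (dist0 D) leqNgt hz.
(* The tail moves outwards: a vertex [a] of layer [i], complete to the next layer, is put in front
   of [c c']. *)
have TS i : i.+1 < d u -> T i -> T i.+1.
  move=> iu Ti; have Ci := TC i iu Ti; have [c [c' [c'' [[ca cc' c'c'' c'z c''z] cz]]]] := Ti.
  have [a aK da] := level_exists uK D (ltnW (ltnW iu)).
  exists a, c, c'; split; first split=> //.
  - by move=> b bK db; exact: (Ci a b aK bK da db).
  - exact: adjC (ca a aK da).
  - by move=> z zK /andP[/ltnW h ?]; apply: cz => //; apply/andP.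
  move=> z zK /andP[hz _]; apply/negP=> az.
  by have := dadj a z aK zK az; rewrite da leqNgt hz.
have Tall i : 0 < i < d u -> T i.
  by elim: i => // -[|i] IHi iu //; apply: TS => //; apply: IHi; apply: ltnW.
case=> [|i] iu b s bK sK db ds; last first.
  by apply: (TC i.+1) => //; apply: Tall; apply: ltnW.
have [p [pK ps dp]] := dist_pred D sK ds.
by rewrite (dist_eq0 D bK db) -(dist_eq0 D pK dp).
Qed.

Hypothesis Kclosed : forall p q, p \in K -> adj p q -> q \notin H -> q \in K.
Hypothesis Kcon : forall p q, p \in K -> q \in K ->
  connect (fun a b => [&& adj a b, a \notin H & b \notin H]) p q.
Hypothesis AK : {subset A <= K}.

Lemma distance_in_K v : v \in K -> exists d, distance K v d.
Proof.
move=> vK; apply: (distance_exists vK _ (fun z zK => Kcon vK zK)).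
by move=> p q pK /and3P[pq _ qH]; split=> //; apply: Kclosed pq qH.
Qed.

Lemma dist1 v d z : v \in K -> z \in K -> distance K v d -> adj v z -> d z = 1.
Proof.
move=> vK zK D vz; have := dist_adj D vK zK vz; rewrite (dist0 D).
case e : (d z) => [|[|n]] // _.
by rewrite (dist_eq0 D zK e) adj_irr in vz.
Qed.

Lemma adj_dist1 v d z : z \in K -> distance K v d -> d z = 1 -> adj v z.
Proof.
move=> zK D dz; have [p [pK pz dp]] := dist_pred D zK dz.
by rewrite -(dist_eq0 D pK dp).
Qed.

Lemma dist2 v d a z : v \in K -> a \in K -> z \in K -> distance K v d ->
  adj v a -> adj a z -> z != v -> d z = 2.
Proof.
move=> vK aK zK D va az zv.
have := dist_adj D aK zK az; rewrite (dist1 vK aK D va).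
case e : (d z) => [|[|[|n]]] // _.
  by rewrite (dist_eq0 D zK e) eqxx in zv.
by have := adj_dist1 zK D e; rewrite (tri va az).
Qed.

(** * Two attached vertices with only clear vertices in the layers between *)

Section Far.

Variables (v v1 v2 : G) (X : seq G) (u2 u1 u U1 U2 : G) (Y : seq G) (V2 V1 : G).
Hypothesis F : frame v v1 v2 X u2 u1 u U1 U2 Y V2 V1.
Variables (dv du : G -> nat).
Hypotheses (Dv : distance K v dv) (Du : distance K u du).
Hypothesis clv : forall z, z \in K -> 0 < dv z < dv u -> clear z.
Hypothesis clu : forall z, z \in K -> 0 < du z < du v -> clear z.

Let c := v :: v1 :: X ++ u1 :: u :: U1 :: Y ++ [:: V1].

Lemma frame_K z : z \in c -> z \in K.
Proof. by have [_ _ E] := frame_spans F; rewrite E => /AK. Qed.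

Let vK : v \in K. Proof. by apply: frame_K; rewrite mem_head. Qed.
Let uK : u \in K.
Proof. by apply: frame_K; rewrite !(inE, mem_cat) eqxx !orbT. Qed.
Let v1K : v1 \in K. Proof. by apply: frame_K; rewrite !inE eqxx orbT. Qed.
Let u1K : u1 \in K.
Proof. by apply: frame_K; rewrite !(inE, mem_cat) eqxx !orbT. Qed.
Let U1K : U1 \in K.
Proof. by apply: frame_K; rewrite !(inE, mem_cat) eqxx !orbT. Qed.
Let v2K : v2 \in K.
Proof.
apply: frame_K; have wX := frame_X F.
rewrite /c !(inE, mem_cat); case: X wX => // z s /andP[/eqP-> _].
by rewrite inE eqxx !orbT.
Qed.

Lemma dist_swap : du v = dv u.
Proof.
have := dist_triangle vK uK Dv Du vK; have := dist_triangle uK vK Du Dv uK.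
rewrite (dist0 Dv) (dist0 Du) !add0n => a b.
by apply/eqP; rewrite eqn_leq a b.
Qed.

Lemma layers_v b s : b \in K -> s \in K -> (dv b).+1 < dv u ->
  dv s = (dv b).+1 -> adj b s.
Proof.
move=> bK sK lt ds.
exact: (layers_complete (frame_v F) vK uK Dv clv lt bK sK).
Qed.

Lemma layers_u b s : b \in K -> s \in K -> (du b).+1 < dv u ->
  du s = (du b).+1 -> adj b s.
Proof.
rewrite -dist_swap => bK sK lt ds.
exact: (layers_complete (frame_u F) uK vK Du clu lt bK sK).
Qed.

Lemma complement_v z : z \in K -> (dv z).+1 < dv u -> dv z + du z = dv u.
Proof. by move=> zK; apply: (level_complement vK uK Dv Du zK layers_v). Qed.

Lemma complement_u z : z \in K -> (du z).+1 < dv u -> dv z + du z = dv u.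
Proof.
move=> zK lt; rewrite addnC -dist_swap; apply: (level_complement uK vK Du Dv zK).
  by rewrite dist_swap; apply: layers_u.
by rewrite dist_swap.
Qed.

Lemma dist_gt4 : 4 < dv u.
Proof.
have [_ _ _ vv1 v1v2 _ _ uU1 _ _ _ vt _] := F.
have dv1 := dist1 vK v1K Dv vv1; have dU1 := dist1 uK U1K Du uU1.
have uv : adj u v = false := frame_nonadj F.
have v2v : v2 != v.
  apply/eqP=> e; have [[_ + _ _] _] := frame_clear F.
  by rewrite e => cl; case/andP: vt; rewrite cl.
case e : (dv u) => [|[|[|[|[|n]]]]] //.
- have [+ _ _] := frame_spans F.
  by rewrite (dist_eq0 Dv uK e) /= !(inE, mem_cat) eqxx !orbT.
- by have := adj_dist1 uK Dv e; rewrite adj_sym uv.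
- have [p [pK pu dp]] := dist_pred Dv uK e.
  by case: (frame_no_common_nbr F (KH pK) (adj_dist1 pK Dv dp) pu).
(* Distance 3: [v1] and [U1] lie in consecutive layers, hence would be adjacent. *)
- have dvU1 : dv U1 = 2.
    by have := complement_u U1K; rewrite dU1 e => /(_ isT); rewrite addn1 => -[].
  have := layers_v v1K U1K; rewrite dv1 e dvU1 (frame_v1U1 F).
  by move=> /(_ isT (erefl _)).
(* Distance 4: [v2] is in the middle layer, hence would be adjacent to [U1]. *)
have dv2 := dist2 vK v1K v2K Dv vv1 v1v2 v2v.
have du2 : du v2 = 2.
  by have := complement_v v2K; rewrite dv2 e => /(_ isT)[].
have := layers_u U1K v2K; rewrite dU1 e du2 adj_sym (frame_v2U1 F).
by move=> /(_ isT (erefl _)).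
Qed.

(** Propagated along paths from [v]: each vertex is far enough from one of the two ends for a
    complement lemma to apply. *)
Lemma dist_sum z : z \in K -> dv z + du z = dv u.
Proof.
have m4 := dist_gt4.
move=> zK; case/connectP: (Kcon vK zK) => s ps ez; rewrite {z}ez in zK *.
have : dv v + du v = dv u by rewrite (dist0 Dv) dist_swap.
elim: s (v) vK ps {zK} => //= q s IHs p pK /andP[/and3P[pq _ qH] ps] sp.
have qK := Kclosed pK pq qH; apply: IHs => //.
have := dist_adj Dv pK qK pq; have := dist_adj Du pK qK pq => hu hv.
have [lt|ge] := ltnP (dv q).+1 (dv u); first exact: complement_v.
(* Here [dv p] is at least [dv u - 2], so [du q] is at most 3, and distance above 4 suffices. *)
by apply: complement_u => //; clear -m4 sp hu hv ge; lia.
Qed.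

(** An edge inside a layer would form a triangle with a predecessor, which is joined to the whole
    layer; the last layer is [u] alone. *)
Lemma dist_step p q : p \in K -> q \in K -> adj p q ->
  (dv q == (dv p).+1) || (dv p == (dv q).+1).
Proof.
move=> pK qK pq; have qp : adj q p by rewrite adj_sym.
have := dist_adj Dv pK qK pq; have := dist_adj Dv qK pK qp.
case: (ltngtP (dv p) (dv q)) => [lt|lt|e] h1 h2.
- by apply/orP; left; rewrite eqn_leq h2 lt.
- by apply/orP; right; rewrite eqn_leq h1 lt.
have sp := dist_sum pK; have sq := dist_sum qK.
case ep : (dv p) => [|n].
  have := ep; rewrite e => eq.
  by rewrite (dist_eq0 Dv pK ep) (dist_eq0 Dv qK eq) adj_irr in pq.
have [r [rK rp dr]] := dist_pred Dv pK ep.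
have [lt|ge] := ltnP (dv p) (dv u).
  have rq : adj r q by apply: layers_v; rewrite // dr -?e -ep.
  by rewrite (tri rp pq) in rq.
have dup : du p = 0 by clear -sp ge; lia.
have duq : du q = 0 by clear -sq ge e; lia.
by rewrite (dist_eq0 Du pK dup) (dist_eq0 Du qK duq) adj_irr in pq.
Qed.

Lemma dist_step_adj p q : p \in K -> q \in K -> dv q = (dv p).+1 -> adj p q.
Proof.
move=> pK qK e; have [lt|ge] := ltnP (dv q) (dv u).
  by apply: layers_v; rewrite -?e.
have sp := dist_sum pK; have sq := dist_sum qK.
have duq : du q = 0 by clear -sq ge; lia.
have dup : du p = 1 by clear -sp sq ge e duq; lia.
by rewrite (dist_eq0 Du qK duq) adj_sym; apply: (adj_dist1 pK Du dup).
Qed.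

Lemma zigzag_walk S r : {in S, forall z, z \in K} ->
  [seq z <- S | dv z == 0] = [:: v] -> r 0 = 0 -> r (dv u) = 0 ->
  (forall i, i < dv u -> count (fun z => dv z == i.+1) S = r i + r i.+1 + 1) ->
  exists2 Z, walk v Z u & perm_eq Z S.
Proof.
move=> SK S0 r0 rm cnt.
have levS : {in S &, forall p q, dv q = (dv p).+1 -> adj p q}.
  by move=> p q pS qS; apply: dist_step_adj; apply: SK.
have [Z [e [R [wZ [eS de] _ szR pZ]]]] := zigzag levS S0 r0 cnt.
have R0 : R = [::] by apply: size0nil; rewrite szR.
have due : du e = 0 by have := dist_sum (SK e eS); rewrite de; clear; lia.
exists Z; first by rewrite -(dist_eq0 Du (SK e eS) due).
move: pZ; rewrite R0 cats0 (_ : [seq z <- S | dv z <= dv u] = S) //.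
apply/all_filterP/allP=> z zS; have := dist_sum (SK z zS).
by clear; lia.
Qed.

Lemma close_walk Z S L N P x y : walk v Z u -> perm_eq Z S ->
  adj v x -> walk x P y -> adj y u -> perm_eq (S ++ L) (c ++ N) ->
  cycle (@adj G) (Z ++ rev P) /\
  perm_eq ((Z ++ rev P) ++ L) (c ++ (N ++ P)).
Proof.
move=> wZ pZ vx wP yu pS; split.
  apply: (@walk_cycle _ v x); last exact: adjC.
  exact: walk_cat wZ (adjC yu) (walk_rev wP).
move/permP: pZ => pZ; move/permP: pS => pS; apply/permP=> Q.
by move: (pZ Q) (pS Q); count_lia Q.
Qed.

Lemma frame_far : False.
Proof.
have [Uc cyc E] := frame_spans F; rewrite -/c in Uc cyc E.
have m4 := dist_gt4.
have vc : v \in c by rewrite mem_head.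
have uc : u \in c by rewrite /c !(inE, mem_cat) eqxx !orbT.
have cK : {in c, forall z, z \in K} by exact: frame_K.
have cycd : cycle (fun p q => (dv q == (dv p).+1) || (dv p == (dv q).+1)) c.
  by apply: (sub_in_cycle dist_step _ cyc); apply/allP.
have c0 : [seq z <- c | dv z == 0] = [:: v].
  rewrite -(filter_pred1_uniq Uc vc); apply: eq_in_filter => z zc /=.
  apply/eqP/eqP=> [|->]; last exact: dist0 Dv.
  by apply: (dist_eq0 Dv); apply: cK.
have cm : count (fun z => dv z == dv u) c = 1.
  rewrite -[1]/(size [:: u]) -(filter_pred1_uniq Uc uc) size_filter.
  apply: eq_in_count => z zc /=; apply/eqP/eqP=> [e|->//].
  apply: (dist_eq0 Du (cK z zc)); have := dist_sum (cK z zc).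
  by rewrite e; clear; lia.
pose k := ascents c dv.
have cnt i : count (fun z => dv z == i.+1) c = k i + k i.+1.
  exact: (count_ascents Uc cycd).
have k0 : k 0 = 1 by rewrite /k -(count_ascents0 Uc cycd) -size_filter c0.
have k_gt0 i : i < dv u -> 0 < k i.
  move=> iu; apply: (ascents_gt0 Uc cycd vc uc).
  by rewrite (dist0 Dv) iu.
have km : k (dv u) = 0.
  have := cnt (dv u); rewrite (@eq_in_count _ _ pred0).
    by rewrite count_pred0; clear; lia.
  move=> z zc /=; have := dist_sum (cK z zc); clear; lia.
have km1 : k (dv u).-1 = 1.
  have := cnt (dv u).-1; rewrite prednK; last by clear -m4; lia.
  by rewrite cm km addn0.
have [x [y [P [[vx yu wP UP PH] xP]]]] := link (frame_u F) (frame_v F).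
have PA z : z \in P -> z \notin A by move/PH/HA.
have P0 : 0 < size P by case: (P) xP.
(* For odd distance the zigzag covers the whole cycle and is closed through [H], which is too
   long. *)
have [om|em] := boolP (odd (dv u)).
  have [r [r0 rm rk]] := leftover_odd k0 k_gt0 km1 km om.
  have [i iu|Z wZ pZ] := zigzag_walk cK c0 r0 rm.
    by rewrite cnt rk.
  have [] := @close_walk Z c [::] [::] P x y wZ pZ vx wP yu (perm_refl _).
  move=> D pD; have := exchange_le optA Uc E UP PA D pD.
  by rewrite leqNgt P0.
(* For even distance [u1], at level [(dv u).-1], is sacrificed; by optimality it then has an
   off-cycle neighbour [z]. *)
have u1c : u1 \in c by rewrite /c !(inE, mem_cat) eqxx !orbT.
have u1u := frame_u1u F.
have du1 : du u1 = 1 by apply: dist1 uK u1K Du (adjC u1u).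
have dv1 : dv u1 = (dv u).-1.
  by have := dist_sum u1K; rewrite du1; clear; lia.
have pS := perm_to_rem u1c.
have SK : {in rem u1 c, forall z, z \in K} by move=> z /mem_rem/cK.
have S0 : [seq z <- rem u1 c | dv z == 0] = [:: v].
  have /perm_small_eq -> // : perm_eq [seq z <- rem u1 c | dv z == 0] [:: v].
  rewrite -c0; move/permP: pS => pS; apply/permP=> Q.
  rewrite !count_filter pS /= dv1; have -> : ((dv u).-1 == 0) = false by clear -m4; lia.
  by rewrite andbF.
have [r [r0 rm rk]] := leftover_drop k0 k_gt0 km1 km em (ltn_trans (isT : 1 < 4) m4).
have [i iu|Z wZ pZ] := zigzag_walk SK S0 r0 rm.
  apply/eqP; rewrite -(eqn_add2r (i.+1 == (dv u).-1)) -rk // -cnt.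
  move/permP: pS => ->; rewrite /= dv1 addnC eq_sym.
  by rewrite [_ == i.+1]eq_sym.
have pL : perm_eq (rem u1 c ++ [:: u1]) (c ++ [::]).
  by rewrite cats0 perm_sym (perm_trans pS) // cats1 perm_sym perm_rcons.
have [D pD] := close_walk wZ pZ vx wP yu pL.
have [x' x'H xx'] := Hnbr (PH x xP).
have [] := exchange_eq optA Uc E UP PA D pD P0 xP xx' (HA x'H).
  by move=> l; rewrite inE => /eqP->; rewrite -E.
move=> l [z []]; rewrite !inE => /eqP-> u1z; case/orP=> [/eqP zw|zA].
  by rewrite zw adj_irr in u1z.
have [zH _] := frame_z (frame_swap F) zA u1z.
have zK := Kclosed u1K u1z zH.
(* Level [dv u] contains only [u], which is on the cycle, so [z] lies on the other side of [u1]. *)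
have dz : dv z = (dv u).-2.
  have := dist_step u1K zK u1z; rewrite dv1.
  case/orP=> /eqP e; last by rewrite -[_.-2]/((dv u).-1.-1) e.
  have duz : du z = 0 by have := dist_sum zK; rewrite e; clear -m4; lia.
  by move: zA; rewrite (dist_eq0 Du zK duz) -E uc.
(* With [z] added at that level, the zigzag covers the cycle and [z], so nothing is lost. *)
have [r' [r0' rm' rk']] := leftover_add k0 k_gt0 km1 km em (ltnW m4).
have [||i iu|Z' wZ' pZ'] := @zigzag_walk (z :: c) r' _ _ r0' rm'.
- by move=> t; rewrite inE => /orP[/eqP->|/cK].
- rewrite -cat1s filter_cat c0 /= dz ifF //.
  by clear -m4; lia.
- by rewrite -cat1s count_cat cnt /= dz addn0 -rk' // addnC eq_sym.
have pN : perm_eq ((z :: c) ++ [::]) (c ++ [:: z]).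
  by rewrite cats0 perm_sym cats1 perm_rcons.
have [D' pD'] := close_walk wZ' pZ' vx wP yu pN.
have := exchange_le optA Uc E _ _ D' pD'.
have -> : uniq ([:: z] ++ P) by rewrite /= UP andbT; apply: contra zH => /PH.
move=> /(_ isT) h; suff : size ([:: z] ++ P) <= 0 by [].
by apply: h => t; rewrite /= inE => /orP[/eqP->|/PA].
Qed.

End Far.

(** By strong induction on the distance: an attached vertex strictly between would give a closer
    pair, so the layers between are clear. *)
Lemma no_attached_pair c : spans c -> forall m v u d,
  attached v -> attached u -> u != v -> distance K v d -> d u = m -> False.
Proof.
move=> sp m; elim/ltn_ind: m => m IHm v u d vt ut uv D du.
have [v1 [v2 [X [u2 [u1 [U1 [U2 [Y [V2 [V1 F]]]]]]]]]] := frame_exists sp vt ut uv.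
have attK w : attached w -> w \in K by case/andP=> /AK.
have [d' D'] := distance_in_K (attK u ut).
have cl w e : attached w -> distance K w e -> e (if w == v then u else v) = m ->
    forall z, z \in K -> 0 < e z < m -> clear z.
  move=> wt De em z zK /andP[z0 zm]; apply/negPn/negP=> nz.
  have [zA|zA] := boolP (z \in A); last first.
    by rewrite (clear_out zA (KH zK)) in nz.
  have zt : attached z by rewrite /attached zA.
  apply: (IHm (e z) zm w z e wt zt) => //.
  by apply: contraTneq z0 => ->; rewrite (dist0 De).
have sw : d' v = m.
  by rewrite -du; apply: (dist_swap F D D').
apply: (frame_far F D D') => z zK; rewrite ?du ?sw.
  by apply: (cl v d vt D); rewrite // eqxx.
by apply: (cl u d' ut D'); rewrite // (negPf uv).
Qed.

End Layers.

(** * Two attachments, from 2-connectedness *)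

Hypothesis cut : forall w (B : {set G}) a b, a \in B -> b \notin B ->
  a != w -> b != w -> exists p q, [/\ p \in B, q \notin B, adj p q & q != w].

Lemma attached_avoiding x w : x \in H -> w \in A ->
  exists2 v, attached v & v != w.
Proof.
move=> xH wA; have [_ A2 _] := optA.
have [b bA bw] : exists2 b, b \in A & b != w.
  have : 0 < #|A :\ w| by move: A2; rewrite (cardsD1 w) wA; clear; lia.
  by case/card_gt0P=> b; rewrite !inE => /andP[]; exists b.
have bH : b \notin H by apply: contraL bA => /HA.
have xw : x != w by apply: contraTneq wA => <-; apply: HA.
have [p [q [pH qH pq qw]]] := cut xH bH xw bw.
exists q => //; apply/andP; split.
  by apply: contraNT qH; apply: Hout pq.
by rewrite negb_forall_in; apply/exists_inP; exists p => //; rewrite negbK.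
Qed.

Lemma no_nontrivial_component x : x \in H -> False.
Proof.
move=> xH; have [[c [Uc cyc E]] A2 _] := optA.
have sp : spans c by split.
have [c0 c0A] : exists c0, c0 \in A by apply/card_gt0P; clear -A2; lia.
have [u ut _] := attached_avoiding xH c0A.
have uA : u \in A by case/andP: ut.
have [v vt vu] := attached_avoiding xH uA.
have uH : u \notin H by apply: contraL uA => /HA.
pose e a b := [&& adj a b, a \notin H & b \notin H].
have e_sym : connect_sym e.
  by apply: sym_connect_sym => a b; rewrite /e adj_sym [(a \notin _) && _]andbC.
(* The component of [u] outside [H]; it contains all of [A], since the cycle avoids [H]. *)
pose K := [set z | (z \notin H) && connect e u z].
have KH z : z \in K -> z \notin H by rewrite inE => /andP[].
have Kclosed p q : p \in K -> adj p q -> q \notin H -> q \in K.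
  rewrite !inE => /andP[pH up] pq qH; rewrite qH; apply: connect_trans up _.
  by apply: connect1; rewrite /e pq pH.
have Kcon p q : p \in K -> q \in K -> connect e p q.
  rewrite !inE => /andP[_ up] /andP[_]; apply: connect_trans.
  by rewrite e_sym.
have AK : {subset A <= K}.
  have [s sp'] : exists s, spans (u :: s).
    move: uA; rewrite -E => uc; case/splitPr: uc sp => a b.
    by exists (b ++ a); apply: (@rot_spans a (u :: b)).
  have [_ + E'] := sp'; rewrite /= rcons_path => /andP[ps _].
  have pe : path e u s.
    have sAe : {in A &, subrel (@adj G) e}.
      move=> a b aA bA ab; rewrite /e ab.
      by rewrite (contraL (@HA a) aA) (contraL (@HA b) bA).
    by apply: (sub_in_path sAe) ps; apply/allP=> z; rewrite E'.
  move=> z zA; rewrite inE; apply/andP; split.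
    by apply: contraL zA => /HA.
  by apply: (path_connect pe); rewrite inE -in_cons E'.
have uK : u \in K by apply: AK.
have [d D] := distance_in_K Kclosed Kcon uK.
by apply: (no_attached_pair KH Kclosed Kcon AK sp ut vt vu D (erefl _)).
Qed.

End Component.

(** * Existence of an optimal cycle, and conclusion *)

Lemma connect_cross (T : finType) (e : rel T) (B : pred T) a b :
  connect e a b -> B a -> ~~ B b -> exists p q, [/\ B p, ~~ B q & e p q].
Proof.
case/connectP=> s ps -> {b}; elim: s a ps => /= [a _ ->//|q s IHs a].
case/andP=> aq ps Ba; have [Bq|nBq] := boolP (B q); first exact: IHs.
by exists a, q.
Qed.

Lemma cut_edge (G : sgraph) w (B : {set G}) a b : k_connected 2 G ->
  a \in B -> b \notin B -> a != w -> b != w ->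
  exists p q, [/\ p \in B, q \notin B, adj p q & (p != w) && (q != w)].
Proof.
case=> _ /(_ [set w]); rewrite cards1 => /(_ isT)[_ con] aB bB aw bw.
have inC z : z != w -> z \in ~: [set w] by rewrite !inE.
have [p [q [pB qB pq]]] :=
  connect_cross (con (exist _ a (inC a aw)) (exist _ b (inC b bw)))
    (B := fun z => val z \in B) aB bB.
exists (val p), (val q); split=> //.
by move: (valP p) (valP q); rewrite !inE => -> ->.
Qed.

(** Some vertex [v] has two neighbours [a] and [r]; a path joining them that avoids [v] closes up
    through [v]. *)
Lemma cycle_exists (G : sgraph) : k_connected 2 G -> exists c : seq G, is_cycle c.
Proof.
move=> conG; have [/card_gt2P[v [w [b [_ [vw wb bv]]]]] _] := conG.
have nbr t a : v != a -> t != v -> t != a -> exists2 r, adj v r & r != a.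
  move=> va tv ta.
  have tS : t \notin [set v] by rewrite inE.
  have [p [q [/set1P-> _ vq /andP[_ qa]]]] := cut_edge conG (set11 v) tS va ta.
  by exists q.
have [a va _] := nbr b w vw bv ltac:(by rewrite eq_sym).
have v_neq z : adj v z -> z != v.
  by move=> vz; apply: contraTneq vz => ->; rewrite adj_irr.
have av := v_neq a va; have va' : v != a by rewrite eq_sym.
have [t tv ta] : exists2 t, t != v & t != a.
  have [<-|ba] := eqVneq b a; last by exists b.
  by exists w; rewrite // eq_sym.
have [r vr ra] := nbr t a va' tv ta.
pose e p q := [&& adj p q, p != v & q != v].
have : connect e a r.
  apply/negPn/negP=> nar.
  have aB : a \in [set z | connect e a z] by rewrite inE connect0.
  have rB : r \notin [set z | connect e a z] by rewrite inE.
  have [p [q []]] := cut_edge conG aB rB av (v_neq r vr).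
  rewrite !inE => ap naq pq pqv; case/negP: naq.
  apply: connect_trans ap (connect1 _).
  by rewrite /e pq.
case/connectP=> s0 ps0 er; case/shortenP: ps0 er => s ps Us _ er {s0}.
exists [:: v, a & s]; split.
- by case: s er {ps Us} => // er; rewrite er eqxx in ra.
- rewrite cons_uniq Us andbT inE negb_or va' /=.
  elim: s (a) ps {er Us} => //= q s IHs p /andP[/and3P[_ _ qv] ps].
  by rewrite inE negb_or eq_sym qv (IHs q).
- rewrite /= va rcons_path -er adj_sym vr andbT.
  by apply: sub_path ps => p q /and3P[].
Qed.

Lemma optimal_exists (G : sgraph) : k_connected 2 G ->
  exists c : seq G, is_cycle c /\ optimal [set z in c].
Proof.
case/cycle_exists=> c1 [c1_2 c1U c1c].
pose B := #|{: G * G}|.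
(* A lexicographic weight, length first and then few off-cycle edges, since [B] bounds their
   number. *)
pose f (D : seq G) := size D * B.+1 + (B - #|off_edges [set z in D]|).
pose P (D : {bseq #|G| of G}) := [&& 2 < size D, uniq D & cycle (@adj G) D].
have szU (D : seq G) : uniq D -> size D <= #|G|.
  by move=> /card_uniqP <-; apply: max_card.
have P1 : P (Bseq (szU c1 c1U)) by rewrite /P c1_2 c1U.
case: (arg_maxnP (fun D : {bseq #|G| of G} => f D) P1) => c /and3P[c2 cU cc] cmax.
have card_c : #|[set z in c]| = size c by rewrite cardsE; apply/card_uniqP.
exists c; split; first by split.
split; rewrite ?card_c //; first by exists c; split=> // z; rewrite inE.
move=> D DU Dc D2.
have := cmax (Bseq (szU D DU)); rewrite /P /= D2 DU Dc /f /= => /(_ isT).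
have hB (S : {set G}) : #|off_edges S| <= B by apply: max_card.
move: (hB [set z in c]) (hB [set z in D]).
move: (#|off_edges [set z in c]|) (#|off_edges [set z in D]|) => m n.
clear; move: (size c) (size D) => sc sD mB nB le; split; first by nia.
by move=> e; move: le; rewrite e; lia.
Qed.

Theorem theorem6 (G : sgraph) (hconn : k_connected 2 G)
    (hclaw : free claw_star_star G) (htri : free K3 G) :
  exists c : seq G, longest_cycle c /\ dominating c.
Proof.
have [c [cc opt]] := optimal_exists hconn; exists c; split.
  have [_ cU _] := cc; split=> // D [D2 DU Dc].
  by have [_ _ /(_ D DU Dc D2)[]] := opt; rewrite cardsE (card_uniqP cU).
move=> x0 y0 xy0; apply/orP/negPn/negP; rewrite negb_or => /andP[x0c y0c].
pose A := [set z in c].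
have x0A : x0 \notin A by rewrite inE.
have y0A : y0 \notin A by rewrite inE.
pose e p q := [&& adj p q, p \notin A & q \notin A].
have e_sym : connect_sym e.
  by apply: sym_connect_sym => a b; rewrite /e adj_sym [(a \notin _) && _]andbC.
pose H := [set z | (z \notin A) && connect e x0 z].
have HE x : (x \in H) = (x \notin A) && connect e x0 x by rewrite in_set.
have HA x : x \in H -> x \notin A by rewrite HE => /andP[].
have Hout x z : x \in H -> adj x z -> z \notin A -> z \in H.
  rewrite !HE => /andP[xA x0x] xz zA; rewrite zA; apply: connect_trans x0x _.
  by apply: connect1; rewrite /e xz xA.
have Hcon x y : x \in H -> y \in H -> connect e x y.
  rewrite !HE => /andP[_ x0x] /andP[_]; apply: connect_trans.
  by rewrite e_sym.
have Hwalk x y : x \in H -> y \in H ->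
    exists P, [/\ walk x P y, uniq P & {subset P <= H}].
  move=> xH yH; have /connectP[s0 ps0 ey] := Hcon x y xH yH.
  case/shortenP: ps0 ey => s ps Us _ ey; exists (x :: s); split=> //.
    by rewrite ey; apply: walk_path; apply: sub_path ps => p q /and3P[].
  elim: s x xH ps {Us ey} => [|q s IHs] x xH /= ps z.
    by rewrite inE => /eqP->.
  case/andP: ps => /and3P[xq _ qA] ps; rewrite inE => /orP[/eqP->//|].
  by apply: IHs => //; apply: Hout xq qA.
have x0H : x0 \in H by rewrite HE x0A connect0.
(* The vertex [x0] has the neighbour [y0]; any other vertex has the next one on a path to [x0]. *)
have Hnbr x : x \in H -> exists2 y, y \in H & adj x y.
  move=> xH; have /connectP[[|q s]] := Hcon x x0 xH x0H.
    by move=> _ /= <-; exists y0 => //; apply: Hout x0H xy0 y0A.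
  by case/andP=> /and3P[xq _ qA] _ _; exists q => //; apply: Hout xq qA.
apply: (no_nontrivial_component htri hclaw opt HA Hwalk Hnbr Hout _ x0H).
move=> w B a b aB bB aw bw.
have [p [q [pB qB pq /andP[_ qw]]]] := cut_edge hconn aB bB aw bw.
by exists p, q.
Qed.
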